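(* Let $q$ be an indeterminate, let $f(q,z)=\sum_{n\geq0}\frac{(-1)^nz^n}{q^{\binom{n}{2}}(q;q)_n}\in\mathbb{Q}(q)[[z]]$ and $h(q,z)=\log f(q,z)$. Then $$h(q,z)=\sum_{n\geq1}\frac{(-1)^{n-1}P_{n}(q)}{n\, q^{\binom{n}{2}}(q^n-1)}z^n,$$ where each $P_{n}\in\mathbb{Z}[x]$ is a polynomial with $\deg P_{n}=\binom{n}{2}$, and $P_{dn}(\omega_d)=\binom{2n-1}{n-1}$ for all positive integers $d,n$ and every primitive $d$-th root of unity $\omega_d$.
   Context: $(q;q)_n=\prod_{i=1}^n(1-q^i)$. The logarithm is the formal logarithm of a power series in $z$ with constant term $1$. *)

(* Defs.v *)
From HB Require Import structures.
From mathcomp Require Import all_boot all_order all_algebra.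

Set Implicit Arguments.
Unset Strict Implicit.
Unset Printing Implicit Defensive.

Import GRing.Theory.

Local Open Scope ring_scope.

(* A formal power series in z over K is identified with its sequence of
   coefficients: s n is the coefficient of z^n. *)
Definition fps (K : Type) : Type := nat -> K.

Section FormalPowerSeries.
Variable K : fieldType.
Implicit Types s t : fps K.

Definition fps_one : fps K := fun n => (n == 0%N)%:R.

Definition fps_sub s t : fps K := fun n => s n - t n.

Definition fps_mul s t : fps K := fun n => \sum_(i < n.+1) s i * t (n - i)%N.

Definition fps_exp s k : fps K := iter k (fps_mul s) fps_one.

(* log s = \sum_(k >= 1) (-1)^(k-1) (s - 1)^k / k, meaningful in characteristic
   0 for s with constant term 1.  Then (s - 1)^k has no term of degree < k, so
   the coefficient of z^n only involves 1 <= k <= n (see fps_log_stable). *)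
Definition fps_log s : fps K := fun n =>
  \sum_(1 <= k < n.+1)
     (-1) ^+ k.-1 * fps_exp (fps_sub s fps_one) k n / k%:R.

Lemma fps_exp_order s k n : s 0%N = 0 -> (n < k)%N -> fps_exp s k n = 0.
Proof.
move=> s0; elim: k n => // k IHk n ltnk.
rewrite /fps_exp iterS -/(fps_exp s k) /fps_mul big1 // => -[[|i] /= ltin] _.
  by rewrite s0 mul0r.
by rewrite IHk ?mulr0 // ltn_subLR // (leq_trans ltnk) // addSn ltnS leq_addl.
Qed.

Lemma fps_log_stable s m n : s 0%N = 1 -> (n <= m)%N ->
  \sum_(1 <= k < m.+1)
     (-1) ^+ k.-1 * fps_exp (fps_sub s fps_one) k n / k%:R = fps_log s n.
Proof.
move=> s0 lenm; rewrite (@big_cat_nat _ _ _ n.+1) //= [X in _ + X]big_nat.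
rewrite [X in _ + X]big1 ?addr0 // => k /andP[ltnk _].
by rewrite fps_exp_order ?mulr0 ?mul0r // /fps_sub s0 subrr.
Qed.

(* (x; x)_n *)
Definition qfact (x : K) (n : nat) : K := \prod_(1 <= i < n.+1) (1 - x ^+ i).

End FormalPowerSeries.

(* The field Q(q) *)
Definition Qq : fieldType := {fraction {poly rat}}.

Definition q : Qq := tofrac ('X : {poly rat}).

Definition f : fps Qq := fun n =>
  (-1) ^+ n / (q ^+ 'C(n, 2) * qfact q n).

Definition h : fps Qq := fps_log f.

(* Evaluation of an integer polynomial at a point of a ring *)
Definition evalZ (R : nzRingType) (p : {poly int}) (x : R) : R :=
  (map_poly intr p).[x].

(* Main.v *)
Require Import Defs.
From HB Require Import structures.
From mathcomp Require Import all_boot all_order all_algebra.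
From mathcomp Require Import boolp ring zify.

Set Implicit Arguments.
Unset Strict Implicit.
Unset Printing Implicit Defensive.

Import GRing.Theory.

Local Open Scope ring_scope.

(* Put p = 1/q, so that f(q,z) = \sum_n p^(n^2) z^n / (p;p)_n, and s(z) = f(z/p).
   Then s(z) = s(pz) + z s(p^2 z), hence s(z)/s(pz) = G(z), the continued
   fraction determined by G(z) = 1 + z/G(pz), whose coefficients lie in Z[p].
   Taking z d/dz of logarithms, n (q^n - 1) [z^n]h is the coefficient g_n of
   z G'/G.  A weighted degree count gives deg g_n <= binom(n,2), and G = 1 + z
   at p = 0 gives g_n(0) = (-1)^(n-1); so P_n is, up to sign, the reversal of
   g_n, and it is monic of degree binom(n,2).

   If p is a primitive d-th root of unity, the continued fraction is periodic:
   K = \prod_(j < d) G(p^j z) is an eigenvalue of a product of d transfer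
   matrices, of determinant -z^d and trace T.  As K is invariant under
   z -> pz, so is T, and T has degree < d; thus T = T(0) = 1 and
   K^2 = K + z^d.  Summing z G'/G over the rotations z -> p^j z extracts d g_(dn)
   from the logarithmic derivative of K, which is (d/2)(1 - (1 + 4 z^d)^(-1/2)),
   a generating function of central binomial coefficients. *)

(** * Formal power series *)

(** Convertible to [fps], but able to carry a ring structure over any nonzero commutative ring, such
    as [{poly int}]. *)
Definition pser (R : Type) : Type := nat -> R.

HB.instance Definition _ (R : Type) := gen_eqMixin (pser R).
HB.instance Definition _ (R : Type) := gen_choiceMixin (pser R).

Section PowerSeriesRing.
Variable R : comNzRingType.
Implicit Types (s t u : pser R) (n : nat) (a b : R).

Definition pser_zero : pser R := fun=> 0.
Definition pser_add s t : pser R := fun n => s n + t n.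
Definition pser_opp s : pser R := fun n => - s n.
Definition pser_one : pser R := fun n => (n == 0%N)%:R.
Definition pser_mul s t : pser R := fun n => \sum_(i < n.+1) s i * t (n - i)%N.

Lemma pser_addA : associative pser_add.
Proof. by move=> s t u; apply/funext => n; apply: addrA. Qed.

Lemma pser_addC : commutative pser_add.
Proof. by move=> s t; apply/funext => n; apply: addrC. Qed.

Lemma pser_add0 : left_id pser_zero pser_add.
Proof. by move=> s; apply/funext => n; apply: add0r. Qed.

Lemma pser_addN : left_inverse pser_zero pser_opp pser_add.
Proof. by move=> s; apply/funext => n; apply: addNr. Qed.

HB.instance Definition _ := GRing.isZmodule.Build (pser R)
  pser_addA pser_addC pser_add0 pser_addN.

Definition pser_trunc m s : {poly R} := \poly_(i < m) s i.

Lemma coef_pser_trunc m s n : (n < m)%N -> (pser_trunc m s)`_n = s n.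
Proof. by move=> ltnm; rewrite coef_poly ltnm. Qed.

(** Coefficients of index below m only see truncations at m, so commutativity and associativity are
    inherited from polynomials. *)
Lemma pser_mul_trunc m s t n : (n < m)%N ->
  pser_mul s t n = (pser_trunc m s * pser_trunc m t)`_n.
Proof.
move=> ltnm; rewrite coefM; apply: eq_bigr => i _.
rewrite !coef_pser_trunc ?(leq_ltn_trans (leq_subr _ _)) //.
by apply: leq_ltn_trans ltnm; rewrite -ltnS.
Qed.

Lemma pser_mulC : commutative pser_mul.
Proof.
by move=> s t; apply/funext => n; rewrite !(@pser_mul_trunc n.+1) // mulrC.
Qed.

Lemma pser_mulA : associative pser_mul.
Proof.
have trunc_mul m s t n : (n < m)%N ->
    (pser_trunc m (pser_mul s t))`_n = (pser_trunc m s * pser_trunc m t)`_n.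
  by move=> ltnm; rewrite coef_pser_trunc // (@pser_mul_trunc m).
move=> s t u; apply/funext => n; rewrite !(@pser_mul_trunc n.+1) //.
transitivity ((pser_trunc n.+1 s * (pser_trunc n.+1 t * pser_trunc n.+1 u))`_n).
  rewrite !coefM; apply: eq_bigr => i _; rewrite trunc_mul //.
  by rewrite ltnS leq_subr.
rewrite mulrA !coefM; apply: eq_bigr => i _.
by rewrite trunc_mul ?ltn_ord.
Qed.

Lemma pser_mul1 : left_id pser_one pser_mul.
Proof.
move=> s; apply/funext => n; rewrite /pser_mul big_ord_recl subn0 mul1r.
by rewrite big1 ?addr0 // => i _; rewrite mul0r.
Qed.

Lemma pser_mulDl : left_distributive pser_mul pser_add.
Proof.
move=> s t u; apply/funext => n; rewrite /pser_mul /pser_add -big_split /=.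
by apply: eq_bigr => i _; rewrite mulrDl.
Qed.

Lemma pser_one_neq0 : pser_one != pser_zero.
Proof. by apply/eqP => /(congr1 (@^~ 0%N)) /eqP; rewrite oner_eq0. Qed.

HB.instance Definition _ := GRing.Zmodule_isComNzRing.Build (pser R)
  pser_mulA pser_mulC pser_mul1 pser_mulDl pser_one_neq0.

Lemma pserP s t : (forall n, s n = t n) <-> s = t.
Proof. by split=> [|->]; [apply: funext|]. Qed.

Lemma pserDE s t n : (s + t) n = s n + t n. Proof. by []. Qed.
Lemma pserNE s n : (- s) n = - s n. Proof. by []. Qed.
Lemma pser1E n : (1 : pser R) n = (n == 0%N)%:R. Proof. by []. Qed.
Lemma pserME s t n : (s * t) n = \sum_(i < n.+1) s i * t (n - i)%N.
Proof. by []. Qed.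

Lemma pserMnE s k n : (s *+ k) n = s n *+ k.
Proof. by elim: k => // k IHk; rewrite !mulrSr pserDE IHk. Qed.

Lemma pser_sumE I (r : seq I) (Q : pred I) (F : I -> pser R) n :
  (\sum_(i <- r | Q i) F i) n = \sum_(i <- r | Q i) F i n.
Proof. by elim/big_rec2: _ => // i x s _ <-. Qed.

Lemma pserM0 s t : (s * t) 0%N = s 0%N * t 0%N.
Proof. by rewrite pserME big_ord1. Qed.

Definition pserX : pser R := fun n => (n == 1%N)%:R.

Lemma pserX_mul0 s : (pserX * s) 0%N = 0.
Proof. by rewrite pserM0 mul0r. Qed.

Lemma pserX_mulS s n : (pserX * s) n.+1 = s n.
Proof.
rewrite pserME big_ord_recl mul0r add0r big_ord_recl mul1r subSS subn0.
by rewrite big1 ?addr0 // => i _; rewrite mul0r.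
Qed.

Definition pserC a : pser R := fun n => if n == 0%N then a else 0.

Lemma pserC_mul a s n : (pserC a * s) n = a * s n.
Proof.
rewrite pserME big_ord_recl subn0 big1 ?addr0 // => i _.
by rewrite mul0r.
Qed.

Lemma pserC_is_zmod_morphism : zmod_morphism pserC.
Proof. by move=> a b; apply/pserP => -[|n]; rewrite pserDE pserNE //= subr0. Qed.

Lemma pserC_is_monoid_morphism : monoid_morphism pserC.
Proof.
split=> [|a b]; apply/pserP => n; first by rewrite pser1E /pserC; case: n.
by rewrite pserC_mul /pserC; case: n => [|n]; rewrite ?mulr0.
Qed.

HB.instance Definition _ := GRing.isZmodMorphism.Build _ _ pserC
  pserC_is_zmod_morphism.
HB.instance Definition _ := GRing.isMonoidMorphism.Build _ _ pserC
  pserC_is_monoid_morphism.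

Lemma pserXn_mul k s n :
  (pserX ^+ k * s) n = if (n < k)%N then 0 else s (n - k)%N.
Proof.
elim: k n => [|k IHk] [|n]; rewrite ?expr0 ?mul1r ?subn0 // exprS -mulrA.
  exact: pserX_mul0.
by rewrite pserX_mulS IHk ltnS subSS.
Qed.

(** In s (t - u) = 0 the constant term 1 of s isolates the n-th coefficient of t - u once the lower
    ones vanish; no integrality of R enters. *)
Lemma pser_mulI s t u : s 0%N = 1 -> s * t = s * u -> t = u.
Proof.
move=> s0 /eqP; rewrite -subr_eq0 -mulrBr => /eqP stu0; apply/eqP.
rewrite -subr_eq0; apply/eqP/pserP => n; elim/ltn_ind: n => n IHn.
move/(congr1 (@^~ n)): stu0; rewrite mulrC pserME big_ord_recr /= subnn s0 mulr1.
by rewrite big1 ?add0r // => i _; rewrite IHn ?mul0r.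
Qed.

Lemma pser_exp_order s k n : s 0%N = 0 -> (n < k)%N -> (s ^+ k) n = 0.
Proof.
move=> s0; elim: k n => // k IHk n ltnk.
rewrite exprS pserME big1 // => -[[|i] /= ltin] _; first by rewrite s0 mul0r.
by rewrite IHk ?mulr0 // ltn_subLR // (leq_trans ltnk) // addSn ltnS leq_addl.
Qed.

(** * Fixed points of operators whose n-th output coefficient depends only on lower input
    coefficients *)

Section CausalFixpoint.
Variable Phi : pser R -> pser R.
Hypothesis Phi_causal : forall s t n,
  (forall i, (i < n)%N -> s i = t i) -> Phi s n = Phi t n.

(** By causality, coefficient n of the iterates from 0 no longer changes after n + 1 steps. *)
Definition pser_fix : pser R := fun n => iter n.+1 Phi 0 n.

Lemma pser_fixE : Phi pser_fix = pser_fix.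
Proof.
have stable n m k : (n < m)%N -> (n < k)%N -> iter m Phi 0 n = iter k Phi 0 n.
  elim/ltn_ind: n m k => n IHn [|m] [|k] //; rewrite !ltnS => lenm lenk.
  by apply: Phi_causal => i ltin; apply: IHn => //; apply: leq_trans ltin _.
by apply/pserP => n; apply: Phi_causal => i ltin; apply: stable.
Qed.

End CausalFixpoint.

(** * Dilations z -> az and the derivation z d/dz *)

Definition dilate a s : pser R := fun n => a ^+ n * s n.

Lemma dilate_is_zmod_morphism a : zmod_morphism (dilate a).
Proof. by move=> s t; apply/pserP => n; rewrite /dilate mulrBr. Qed.

Lemma dilate_is_monoid_morphism a : monoid_morphism (dilate a).
Proof.
split=> [|s t]; apply/pserP => n; rewrite /dilate.
  by rewrite pser1E; case: n => [|n]; rewrite ?expr0 ?mulr1 ?mulr0.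
rewrite !pserME mulr_sumr; apply: eq_bigr => -[i /= ltin] _.
by rewrite mulrACA -exprD subnKC.
Qed.

HB.instance Definition _ a := GRing.isZmodMorphism.Build _ _ (dilate a)
  (dilate_is_zmod_morphism a).
HB.instance Definition _ a := GRing.isMonoidMorphism.Build _ _ (dilate a)
  (dilate_is_monoid_morphism a).

Lemma dilateB a s t : dilate a (s - t) = dilate a s - dilate a t.
Proof. exact: rmorphB. Qed.

Lemma dilateM a s t : dilate a (s * t) = dilate a s * dilate a t.
Proof. exact: rmorphM. Qed.

Lemma dilateE a s n : dilate a s n = a ^+ n * s n. Proof. by []. Qed.

Lemma dilate_pserX a : dilate a pserX = pserC a * pserX.
Proof.
apply/pserP => n; rewrite pserC_mul dilateE /pserX.
by case: n => [|[|n]]; rewrite ?mulr0 ?expr1.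
Qed.

Lemma dilate_id s : dilate 1 s = s.
Proof. by apply/pserP => n; rewrite dilateE expr1n mul1r. Qed.

Lemma dilate_comp a b s : dilate a (dilate b s) = dilate (a * b) s.
Proof. by apply/pserP => n; rewrite !dilateE exprMn mulrA. Qed.

Lemma dilate_at0 a s : dilate a s 0%N = s 0%N.
Proof. by rewrite dilateE mul1r. Qed.

(* The derivation z d/dz. *)
Definition theta s : pser R := fun n => s n *+ n.

Lemma thetaE s n : theta s n = s n *+ n. Proof. by []. Qed.

Lemma theta_at0 s : theta s 0%N = 0. Proof. by []. Qed.

Lemma thetaD s t : theta (s + t) = theta s + theta t.
Proof. by apply/pserP => n; rewrite thetaE mulrnDl. Qed.

Lemma thetaN s : theta (- s) = - theta s.
Proof. by apply/pserP => n; rewrite thetaE mulNrn. Qed.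

Lemma thetaMn s k : theta (s *+ k) = theta s *+ k.
Proof. by apply/pserP => n; rewrite thetaE !pserMnE mulrnAC. Qed.

Lemma theta1 : theta 1 = 0.
Proof. by apply/pserP => -[|n]; rewrite thetaE ?mulr0n // pser1E mul0rn. Qed.

Lemma thetaM s t : theta (s * t) = theta s * t + s * theta t.
Proof.
apply/pserP => n; rewrite thetaE pserDE !pserME -sumrMnl -big_split /=.
apply: eq_bigr => -[i /= ltin] _; rewrite !thetaE mulrnAl mulrnAr -mulrnDr.
by rewrite subnKC.
Qed.

Lemma thetaXn s k : theta (s ^+ k) = s ^+ k.-1 * theta s *+ k.
Proof.
elim: k => [|k IHk]; first by rewrite theta1.
rewrite exprS thetaM IHk; case: k {IHk} => [|k] /=.
  by rewrite mulr0n mulr0 addr0 mulrC.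
by rewrite mulrnAr mulrA -exprS mulrC -mulrS.
Qed.

Lemma theta_pserXn k : theta (pserX ^+ k) = pserX ^+ k *+ k.
Proof.
apply/pserP => n; rewrite thetaE pserMnE -[pserX ^+ k]mulr1 pserXn_mul pser1E.
have [|lekn] := ltnP n k; first by rewrite !mul0rn.
rewrite subn_eq0; case: (leqP n k) => [lenk|_]; last by rewrite !mul0rn.
by have -> : n = k by apply/eqP; rewrite eqn_leq lenk.
Qed.

Lemma theta_dilate a s : theta (dilate a s) = dilate a (theta s).
Proof. by apply/pserP => n; rewrite !thetaE !dilateE thetaE mulrnAr. Qed.

End PowerSeriesRing.
Arguments pserX {R}.

(** * The continued fraction G(z) = 1 + z/G(az) *)

Section QContinuedFraction.
Variables (R : comNzRingType) (a : R).

Lemma qcf_op_causal (s t : pser R) n :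
  (forall i, (i < n)%N -> s i = t i) ->
  (1 - pserX * (dilate a s * s)) n = (1 - pserX * (dilate a t * t)) n.
Proof.
move=> eq_st; rewrite !pserDE !pserNE; congr (_ - _).
case: n eq_st => [|n] eq_st; first by rewrite !pserX_mul0.
rewrite !pserX_mulS !pserME; apply: eq_bigr => -[i /= ltin] _.
by rewrite !dilateE !eq_st // ltnS leq_subr.
Qed.

(* Solving for V = 1/G, i.e. V(z) = 1 - z V(az) V(z), avoids inverting series in
   the recursion. *)
Definition qcf_inv : pser R :=
  pser_fix (fun s : pser R => 1 - pserX * (dilate a s * s)).

Definition qcf : pser R := 1 + pserX * dilate a qcf_inv.

Lemma qcf_invE : qcf_inv = 1 - pserX * (dilate a qcf_inv * qcf_inv).
Proof. by rewrite {1}/qcf_inv -(pser_fixE qcf_op_causal). Qed.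

Lemma qcf_inv_at0 : qcf_inv 0%N = 1.
Proof. by rewrite qcf_invE pserDE pserNE pserX_mul0 subr0. Qed.

Lemma qcf_invS n :
  qcf_inv n.+1 = - \sum_(i < n.+1) a ^+ i * qcf_inv i * qcf_inv (n - i)%N.
Proof.
by rewrite {1}qcf_invE pserDE pserNE pserX_mulS pser1E add0r.
Qed.

Lemma qcf_at0 : qcf 0%N = 1.
Proof. by rewrite /qcf pserDE pserX_mul0 addr0. Qed.

Lemma qcfS n : qcf n.+1 = a ^+ n * qcf_inv n.
Proof. by rewrite /qcf pserDE pserX_mulS pser1E add0r. Qed.

Lemma qcfV : qcf * qcf_inv = 1.
Proof. by rewrite /qcf mulrDl mul1r {1}qcf_invE; ring. Qed.

(** The series z G'/G, whose n-th coefficient is called g_n. *)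
Definition qcf_dlog : pser R := theta qcf * qcf_inv.

Lemma qcf_dlog_at0 : qcf_dlog 0%N = 0.
Proof. by rewrite /qcf_dlog pserM0 theta_at0 mul0r. Qed.

Lemma theta_qcf : theta qcf = qcf * qcf_dlog.
Proof. by rewrite /qcf_dlog mulrCA qcfV mulr1. Qed.

Lemma qcf_dilate : qcf * dilate a qcf = dilate a qcf + pserX.
Proof.
rewrite {1}/qcf mulrDl mul1r -mulrA -dilateM [qcf_inv * _]mulrC qcfV rmorph1 mulr1.
by [].
Qed.

End QContinuedFraction.

(** * Compatibility with ring morphisms *)

Section QContinuedFractionMorphism.
Variables (R S : comNzRingType) (phi : {rmorphism R -> S}) (a : R).

(** The recursion [qcf_invS] is polynomial in a, so coefficients computed once over [{poly int}]
    specialise to 0, to 1/q and to roots of unity. *)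
Lemma qcf_inv_rmorph n : phi (qcf_inv a n) = qcf_inv (phi a) n.
Proof.
elim/ltn_ind: n => -[|n] IHn; first by rewrite !qcf_inv_at0 rmorph1.
rewrite !qcf_invS rmorphN rmorph_sum; congr (- _).
apply: eq_bigr => -[i /= ltin] _.
by rewrite !rmorphM rmorphXn !IHn // ltnS leq_subr.
Qed.

Lemma qcf_dlog_rmorph n : phi (qcf_dlog a n) = qcf_dlog (phi a) n.
Proof.
rewrite /qcf_dlog !pserME rmorph_sum; apply: eq_bigr => -[i /= _] _.
rewrite !thetaE rmorphM rmorphMn /= qcf_inv_rmorph.
case: i => [|i]; first by rewrite !mulr0n.
by rewrite !qcfS rmorphM rmorphXn /= qcf_inv_rmorph.
Qed.

End QContinuedFractionMorphism.

(** At a = 0 the continued fraction is 1 + z, and z G'/G = z/(1 + z). *)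
Lemma qcf_dlog0 (R : comNzRingType) n : qcf_dlog (0 : R) n.+1 = (-1) ^+ n.
Proof.
have dil0 : dilate 0 (qcf_inv (0 : R)) = 1.
  apply/pserP => -[|i]; rewrite dilateE; first by rewrite qcf_inv_at0 mulr1.
  by rewrite exprS !mul0r.
have inv0 i : qcf_inv (0 : R) i = (-1) ^+ i.
  elim: i => [|i IHi]; first exact: qcf_inv_at0.
  by rewrite qcf_invE dil0 mul1r pserDE pserNE pserX_mulS IHi add0r exprS mulN1r.
rewrite /qcf_dlog /qcf dil0 mulr1 thetaD theta1 add0r.
by rewrite -[pserX]expr1 theta_pserXn expr1 pserX_mulS inv0.
Qed.

Lemma bin2_add_mul i j : 'C(i + j, 2) = ('C(i, 2) + 'C(j, 2) + i * j)%N.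
Proof.
elim: i => [|i IHi]; first by rewrite !add0n mul0n addn0.
by rewrite addSn !binS IHi !bin1; lia.
Qed.

(** * Degrees of the coefficients in a *)

Section DegreeBounds.
Implicit Types (s t : pser {poly int}).

(* deg s_n <= binom(n,2) is stable under products since
   binom(i,2) + binom(j,2) <= binom(i+j,2). *)
Definition bin2_size s := forall n, (size (s n) <= 'C(n, 2).+1)%N.

Lemma size_mul_leq_succ (p r : {poly int}) m n :
  (size p <= m.+1)%N -> (size r <= n.+1)%N -> (size (p * r)%R <= (m + n).+1)%N.
Proof.
move=> szp szr; apply: leq_trans (size_polyMleq _ _) _.
by rewrite -subn1 leq_subLR; lia.
Qed.

Lemma bin2_size_mul s t : bin2_size s -> bin2_size t -> bin2_size (s * t).
Proof.
move=> szs szt n; rewrite pserME; apply: leq_trans (size_sum _ _ _) _.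
apply/bigmax_leqP => -[i /= ltin] _.
apply: leq_trans (size_mul_leq_succ (szs i) (szt _)) _.
by rewrite -{2}(subnKC (ltin : i <= n)%N) bin2_add_mul ltnS leq_addr.
Qed.

Lemma bin2_size_theta s : bin2_size s -> bin2_size (theta s).
Proof.
move=> szs n; rewrite thetaE -mulr_natr -polyC_natr mulrC mul_polyC.
exact: leq_trans (size_scale_leq _ _) _.
Qed.

(** In the recursion, the extra factor a^i turns binom(i,2) into binom(i+1,2), and binom(i+1,2) +
    binom(n-i,2) <= binom(n+1,2). *)
Lemma bin2_size_qcf_inv : bin2_size (qcf_inv 'X).
Proof.
move=> n; elim/ltn_ind: n => -[|n] IHn; first by rewrite qcf_inv_at0 size_poly1.
rewrite qcf_invS size_polyN; apply: leq_trans (size_sum _ _ _) _.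
apply/bigmax_leqP => -[i /= ltin] _.
have szXn : (size ('X^i : {poly int}) <= i.+1)%N by rewrite size_polyXn.
apply: leq_trans (size_mul_leq_succ
  (size_mul_leq_succ szXn (IHn i ltin)) (IHn (n - i)%N _)) _.
  by rewrite ltnS leq_subr.
have -> : n.+1 = (i.+1 + (n - i))%N by rewrite addSn subnKC.
rewrite bin2_add_mul binS bin1 [(i + _)%N]addnC ltnS.
exact: leq_addr.
Qed.

Lemma bin2_size_qcf_dlog : bin2_size (qcf_dlog 'X).
Proof.
apply: bin2_size_mul bin2_size_qcf_inv; apply: bin2_size_theta => -[|n].
  by rewrite qcf_at0 size_poly1.
have szXn : (size ('X^n : {poly int}) <= n.+1)%N by rewrite size_polyXn.
rewrite qcfS; apply: leq_trans (size_mul_leq_succ szXn (bin2_size_qcf_inv n)) _.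
by rewrite binS bin1 addnC.
Qed.

End DegreeBounds.

(** * The polynomials P_n *)

Section RationalPolynomials.

(** Up to sign, the reversal x^binom(n,2) g_n(1/x), where g_n is taken at a = x in Z[x]. *)
Definition qlog_poly n : {poly int} :=
  (-1) ^+ n.-1 * \poly_(i < 'C(n, 2).+1) (qcf_dlog 'X n)`_('C(n, 2) - i).

Lemma size_qlog_poly n : (0 < n)%N -> size (qlog_poly n) = 'C(n, 2).+1.
Proof.
move=> n_gt0; transitivity
  (size (\poly_(i < 'C(n, 2).+1) (qcf_dlog 'X n : {poly int})`_('C(n, 2) - i))).
  by rewrite /qlog_poly -signr_odd mulr_sign; case: odd; rewrite ?size_polyN.
case: n n_gt0 => // n _; rewrite size_poly_eq // subnn.
(* The leading coefficient of the reversal is the constant term of g_n. Taking constant terms is a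
   ring morphism sending ['X] to 0, so it equals g_n(0), a sign. *)
have := qcf_dlog_rmorph (coefp 0 : {rmorphism {poly int} -> int}) 'X n.+1.
by rewrite /= coefX qcf_dlog0 => ->; rewrite signr_eq0.
Qed.

Lemma evalZ_rev (F : fieldType) (p : {poly int}) m (x : F) :
    x != 0 -> (size p <= m.+1)%N ->
  evalZ (\poly_(i < m.+1) p`_(m - i)) x = x ^+ m * evalZ p x^-1.
Proof.
move=> x0 szp; rewrite /evalZ (@horner_coef_wide _ m.+1); last first.
  by apply: leq_trans (size_poly _ _) _; apply: size_poly.
rewrite [in RHS](@horner_coef_wide _ m.+1); last first.
  exact: leq_trans (size_poly _ _) szp.
rewrite mulr_sumr (reindex_inj rev_ord_inj); apply: eq_bigr => -[i /= ltim] _.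
rewrite !coef_map coef_poly /= subSS ltnS leq_subr subKn // mulrCA exprVn.
by rewrite -expfB_cond ?(negPf x0) ?add0n.
Qed.

Lemma evalZ_qlog_poly (F : fieldType) n (x : F) : x != 0 ->
  evalZ (qlog_poly n) x = (-1) ^+ n.-1 * x ^+ 'C(n, 2) * qcf_dlog x^-1 n.
Proof.
move=> x0.
pose phi y : {rmorphism {poly int} -> F} := horner_eval y \o map_poly intr.
have evalE y (p : {poly int}) : evalZ p y = phi y p by [].
rewrite evalE rmorphM rmorphXn rmorphN1 -evalE evalZ_rev //.
  rewrite evalE qcf_dlog_rmorph mulrA; congr (_ * qcf_dlog _ _).
  by rewrite -evalE /evalZ map_polyX hornerX.
exact: bin2_size_qcf_dlog.
Qed.

End RationalPolynomials.

(** * The logarithm of f *)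

Section Logarithm.
Variable K : fieldType.
Implicit Types s : pser K.

Lemma fps_expE s k : fps_exp s k = s ^+ k.
Proof. by elim: k => // k IHk; rewrite /fps_exp iterS -/(fps_exp s k) IHk exprS. Qed.

Lemma pser_signE s k n : ((-1) ^+ k * s) n = (-1) ^+ k * s n.
Proof. by rewrite -signr_odd mulr_sign -[in RHS]signr_odd mulr_sign; case: odd. Qed.

(** With u = s - 1, differentiating the logarithm termwise gives theta s times the geometric series
    in -u, whose sum is 1/s. *)
Lemma theta_fps_log s : (forall k, k.+1%:R != 0 :> K) -> s 0%N = 1 ->
  theta (fps_log s : pser K) * s = theta s.
Proof.
move=> charK s0; pose u := s - 1.
have u0 : u 0%N = 0 by rewrite /u pserDE pserNE s0 subrr.
have theta_u : theta u = theta s by rewrite thetaD thetaN theta1 subr0.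
have theta_log n m : (n <= m)%N ->
    theta (fps_log s : pser K) n = (theta s * \sum_(k < m) (- u) ^+ k) n.
  move=> lenm; rewrite thetaE -(fps_log_stable s0 lenm) mulr_sumr pser_sumE.
  rewrite big_add1 big_mkord -sumrMnl; apply: eq_bigr => k _.
  rewrite fps_expE -[fps_sub _ _]/u -mulrnAl -mulrnAr.
  rewrite -(thetaE (u ^+ k.+1)) thetaXn pserMnE.
  rewrite -[_ *+ k.+1]mulr_natr mulrA mulfK //= (exprNn u) mulrCA pser_signE.
  by rewrite theta_u [theta s * _]mulrC.
apply/pserP => n.
have -> : (theta (fps_log s : pser K) * s) n
  = (theta s * \sum_(k < n.+1) (- u) ^+ k * s) n.
  rewrite -mulr_suml mulrA [LHS]pserME [RHS]pserME.
  apply: eq_bigr => -[i /= ltin] _; congr (_ * _).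
  by apply: theta_log; apply: leqW.
have -> : \sum_(k < n.+1) (- u) ^+ k * s = 1 - (- u) ^+ n.+1.
  rewrite -mulr_suml -[1](expr1n _ n.+1) subrXX [RHS]mulrC.
  congr (_ * _); last by rewrite /u; ring.
  by apply: eq_bigr => i _; rewrite expr1n mul1r.
(* The remainder (-u)^(n+1) starts at z^(n+1), so it is invisible in coefficient n. *)
rewrite mulrBr mulr1 pserDE pserNE pserME big1 ?subr0 // => -[i /= ltin] _.
by rewrite [X in _ * X]pser_exp_order ?mulr0 ?pserNE ?u0 ?oppr0 // ltnS leq_subr.
Qed.

End Logarithm.

(** The recurrence forces s(z) = G(z) s(az); then take logarithmic derivatives, with theta l
    standing for theta s / s. *)
Lemma theta_log_quotient (R : comNzRingType) (a : R) (s l : pser R) :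
    s 0%N = 1 -> s = dilate a s + pserX * dilate a (dilate a s) ->
    theta l * s = theta s -> theta l - dilate a (theta l) = qcf_dlog a.
Proof.
move=> s0 s_rec l_s; pose V := qcf_inv a; pose G := qcf a.
pose D := s * V - dilate a s.
(* The factor z makes each coefficient of D a combination of earlier ones, so this homogeneous
   equation has only the solution 0. *)
have D_rec : D = - pserX * (dilate a V * D + dilate a D).
  have sV : s * V = s - pserX * (dilate a V * (s * V)).
    by rewrite {1}/V qcf_invE -/V; ring.
  have dil_s : dilate a s = s - pserX * dilate a (dilate a s).
    exact: canRL (addrK _) (esym s_rec).
  rewrite {1}/D {1}sV {1}dil_s /D (dilateB a (s * V)).
  by rewrite (dilateM a s V); ring.
have D0 : D = 0.
  apply/pserP => n; elim/ltn_ind: n => -[|n] IHn; rewrite D_rec mulNr pserNE.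
    by rewrite pserX_mul0 oppr0.
  rewrite pserX_mulS pserDE pserME big1 => [|i _].
    by rewrite dilateE IHn // mulr0 addr0 oppr0.
  by rewrite IHn ?mulr0 // ltnS leq_subr.
have sV : s = dilate a s * G.
  by rewrite -(subr0_eq D0) -mulrA [V * _]mulrC qcfV mulr1.
apply: (pser_mulI s0).
have theta_s : theta s = theta (dilate a s * G) by congr theta.
rewrite mulrBr [s * theta l]mulrC l_s theta_s thetaM theta_qcf -/G theta_dilate.
rewrite -l_s dilateM; transitivity ((dilate a s * G) * dilate a (theta l)
  + (dilate a s * G) * qcf_dlog a - s * dilate a (theta l)); first by ring.
by rewrite -sV; ring.
Qed.

Section LogCoefficients.
Variables (K : fieldType) (x : K).
Hypotheses (x_neq0 : x != 0) (x_aperiodic : forall k, x ^+ k.+1 != 1).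
Hypothesis charK : forall k, k.+1%:R != 0 :> K.

(** The series f at a point x of a general field. With p = 1/x it is the Rogers-Ramanujan series
    with terms p^(n^2) z^n / (p;p)_n. *)
Definition rr_series : pser K := fun n => (-1) ^+ n / (x ^+ 'C(n, 2) * qfact x n).

Lemma qfactS n : qfact x n.+1 = qfact x n * (1 - x ^+ n.+1).
Proof. by rewrite /qfact big_nat_recr. Qed.

Lemma qfact_neq0 n : qfact x n != 0.
Proof.
elim: n => [|n IHn]; first by rewrite /qfact big_nil oner_eq0.
by rewrite qfactS mulf_neq0 // subr_eq0 eq_sym.
Qed.

Lemma rr_series_at0 : rr_series 0%N = 1.
Proof. by rewrite /rr_series /qfact big_nil mulr1 divr1. Qed.

(** In s(z) - s(pz), p = 1/x, the factor 1 - p^(n+1) at z^(n+1) cancels against the last factor of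
    [qfact x n.+1], leaving p^(2n) s_n. *)
Lemma rr_series_rec (s := dilate x rr_series) :
  s = dilate x^-1 s + pserX * dilate x^-1 (dilate x^-1 s).
Proof.
apply/pserP => -[|n]; rewrite pserDE.
  by rewrite pserX_mul0 addr0 dilate_at0.
rewrite pserX_mulS /s !dilateE /rr_series qfactS !exprS binS bin1 exprD !exprVn.
have xn0 : x ^+ n != 0 by rewrite expf_neq0.
have xC0 : x ^+ 'C(n, 2) != 0 by rewrite expf_neq0.
have q0 := qfact_neq0 n.
have xS0 : 1 - x * x ^+ n != 0 by rewrite subr_eq0 eq_sym -exprS.
by field; rewrite ?x_neq0 ?xn0 ?xC0 ?q0 ?xS0.
Qed.

Lemma fps_log_rr_series n :
  (x ^+ n - 1) * (fps_log rr_series n *+ n) = qcf_dlog x^-1 n.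
Proof.
pose h : pser K := fps_log rr_series.
have log_h : theta (dilate x h) * dilate x rr_series = theta (dilate x rr_series).
  rewrite (theta_dilate _ h) (theta_dilate _ rr_series) -dilateM.
  by rewrite theta_fps_log // rr_series_at0.
have s0 : dilate x rr_series 0%N = 1 by rewrite dilate_at0 rr_series_at0.
rewrite -(theta_log_quotient s0 rr_series_rec log_h) pserDE pserNE (theta_dilate _ h).
by rewrite dilate_comp mulVf // dilate_id dilateE thetaE -/h; ring.
Qed.

Lemma fps_log_rr_seriesE n : fps_log rr_series n = if n == 0%N then 0 else
  (-1) ^+ n.-1 * evalZ (qlog_poly n) x / (n%:R * x ^+ 'C(n, 2) * (x ^+ n - 1)).
Proof.
case: n => [|n]; first by rewrite /fps_log big_geq.
have xn0 : x ^+ n.+1 - 1 != 0 by rewrite subr_eq0.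
have xC0 : x ^+ 'C(n.+1, 2) != 0 by rewrite expf_neq0.
rewrite evalZ_qlog_poly // -fps_log_rr_series -(mulr_natl (fps_log _ _)) /= !mulrA.
rewrite -expr2 sqrr_sign mul1r.
move: (charK n) xn0 xC0; set N := n.+1%:R; set y := x ^+ n.+1 - 1; set z := x ^+ _.
move=> N0 y0 z0; set t := fps_log _ _; clearbody N y z t.
by field; rewrite ?z0 ?y0 ?N0.
Qed.

End LogCoefficients.

Lemma qlog_poly_log n : h n = if n == 0%N then 0 else
  (-1) ^+ n.-1 * evalZ (qlog_poly n) q / (n%:R * q ^+ 'C(n, 2) * (q ^+ n - 1)).
Proof.
have q0 : q != 0 by rewrite tofrac_eq0 polyX_eq0.
have q_aper k : q ^+ k.+1 != 1.
  rewrite -(rmorph1 (@tofrac {poly rat})) -rmorphXn /= tofrac_eq.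
  apply/eqP => /(congr1 (fun p : {poly rat} => size p)).
  by rewrite size_polyXn size_poly1.
have charQq k : k.+1%:R != 0 :> Qq.
  rewrite -(rmorph_nat (@tofrac {poly rat})) tofrac_eq0 -polyC_natr polyC_eq0.
  by rewrite Num.Theory.pnatr_eq0.
exact: (fps_log_rr_seriesE q0 q_aper charQq n).
Qed.

(** * Values at roots of unity *)

Section RootOfUnity.
Variables (K : fieldType) (d : nat) (p : K).
Hypotheses (d_gt0 : (0 < d)%N) (p_prim : d.-primitive_root p).
Hypothesis charK : forall k, k.+1%:R != 0 :> K.

(** Evaluate X^d - 1 = \prod (X - p^i) at 0. *)
Lemma prod_opp_prim_root : \prod_(i < d) (- p ^+ i) = -1.
Proof.
have := congr1 (horner^~ 0) (factor_Xn_sub_1 p_prim).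
rewrite hornerD hornerN hornerC hornerXn expr0n gtn_eqF // sub0r => <-.
by rewrite horner_prod big_mkord; apply: eq_bigr => i _; rewrite !hornerE.
Qed.

Lemma prod_opp_prim_root_mul n : (-1) ^+ (d * n) * p ^+ 'C(d * n, 2) = (-1) ^+ n.
Proof.
have prodE m : \prod_(i < m) (- p ^+ i) = (-1) ^+ m * p ^+ 'C(m, 2).
  elim: m => [|m IHm]; first by rewrite big_ord0 mul1r.
  by rewrite big_ord_recr IHm binS bin1 exprD exprSr /=; ring.
elim: n => [|n IHn]; first by rewrite muln0 !mul1r.
rewrite mulnS bin2_add_mul exprD [p ^+ _]exprD [p ^+ (_ + _)]exprD.
rewrite (exprM p) (prim_expr_order p_prim) expr1n mulr1 mulrACA -prodE IHn.
by rewrite prod_opp_prim_root exprS.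
Qed.

(** * Transfer matrices over one period *)

Let G k := dilate (p ^+ k) (qcf p).
Let Z k : pser K := pserC (p ^+ k) * pserX.
Let Kd := \prod_(i < d) G i.

Lemma dilate_qcf_step k : G k * G k.+1 = G k.+1 + Z k.
Proof.
rewrite /G exprSr -dilate_comp -dilateM qcf_dilate rmorphD /=.
by rewrite dilate_pserX.
Qed.

Lemma dilate_prod_qcf : dilate p Kd = Kd.
Proof.
rewrite /Kd rmorph_prod /=.
transitivity (\prod_(i < d) G i.+1).
  by apply: eq_bigr => i _; rewrite dilate_comp -exprS.
case: d d_gt0 p_prim => // m _ pm.
rewrite big_ord_recr big_ord_recl /= [RHS]mulrC; congr (_ * _).
by rewrite /G (prim_expr_order pm) expr0.
Qed.

Lemma prod_qcf_at0 : Kd 0%N = 1.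
Proof.
rewrite /Kd; elim/big_rec: _ => [//|i s _ s0].
by rewrite pserM0 s0 /G dilate_at0 qcf_at0 mulr1.
Qed.

(* [r] times the product of the matrices [[1, Z j], [1, 0]], j < k, which
   express G j = 1 + Z j / G j.+1. *)
Fixpoint transfer_row (r : pser K * pser K) k : pser K * pser K :=
  if k is m.+1 then
    ((transfer_row r m).1 + (transfer_row r m).2, Z m * (transfer_row r m).1)
  else r.

(** The j-th matrix sends the column (G j.+1, 1) to G j.+1 times the column (G j, 1), by
    [dilate_qcf_step]. *)
Lemma transfer_rowE r k :
  (transfer_row r k).1 * G k + (transfer_row r k).2
    = (r.1 * G 0 + r.2) * \prod_(i < k) G i.+1.
Proof.
elim: k => [|k IHk]; first by rewrite big_ord0 mulr1.
rewrite big_ord_recr /= mulrA -IHk mulrDl -[LHS]addrA.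
set x := (transfer_row r k).1; set y := (transfer_row r k).2.
transitivity (x * (G k.+1 + Z k) + y * G k.+1); first by ring.
by rewrite -dilate_qcf_step; ring.
Qed.

(** Multiplicativity of the determinant: the j-th matrix has determinant - Z j. *)
Lemma transfer_det r1 r2 k :
  (transfer_row r1 k).1 * (transfer_row r2 k).2
    - (transfer_row r1 k).2 * (transfer_row r2 k).1
  = (r1.1 * r2.2 - r1.2 * r2.1) * \prod_(i < k) (- Z i).
Proof.
elim: k => [|k IHk]; first by rewrite big_ord0 mulr1.
by rewrite big_ord_recr /= [RHS]mulrA -IHk; ring.
Qed.

(** From constant entries, k + 1 steps give degrees at most k and k + 1; this will bound the
    trace. *)
Lemma transfer_row_order (r : pser K * pser K) k n :
    (forall i, (0 < i)%N -> r.1 i = 0) -> (forall i, (0 < i)%N -> r.2 i = 0) ->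
    (k < n)%N ->
  (transfer_row r k.+1).1 n = 0 /\ (transfer_row r k.+1).2 n.+1 = 0.
Proof.
move=> r1 r2; elim: k n => [|k IHk] [|n] // ltkn.
  by rewrite /= pserDE -mulrA pserC_mul pserX_mulS r1 // r2 // addr0 mulr0.
have [row1 row2] := IHk n ltkn; have [row1S _] := IHk n.+1 (ltnW ltkn).
split; first by rewrite -[LHS]/(_ n.+1 + _ n.+1) row1S row2 addr0.
rewrite -[LHS]/((Z k.+1 * (transfer_row r k.+1).1) n.+2) -mulrA pserC_mul.
by rewrite pserX_mulS row1S mulr0.
Qed.

Lemma prod_qcf_quadratic : Kd * Kd = Kd + pserX ^+ d.
Proof.
(* The starting rows are those of the identity, so A, B, C, D are the entries of the product of the
   d transfer matrices. *)
pose one : pser K := 1; pose r1 := (one, 0 : pser K); pose r2 := (0 : pser K, one).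
have const1 i : (0 < i)%N -> one i = 0 by case: i.
pose A := (transfer_row r1 d).1; pose B := (transfer_row r1 d).2.
pose C := (transfer_row r2 d).1; pose D := (transfer_row r2 d).2.
have Gd : G d = G 0 by rewrite /G (prim_expr_order p_prim) expr0.
have KdS : \prod_(i < d) G i.+1 = Kd.
  rewrite -[RHS]dilate_prod_qcf [RHS]rmorph_prod /=.
  by apply: eq_bigr => i _; rewrite /G dilate_comp -exprS.
(* By periodicity, the column (G 0, 1) is an eigenvector with eigenvalue [Kd]; [quad] is the
   characteristic equation. *)
have eq1 : A * G 0 + B = G 0 * Kd.
  by have := transfer_rowE r1 d; rewrite Gd KdS /= mul1r addr0.
have eq2 : C * G 0 + D = Kd.
  by have := transfer_rowE r2 d; rewrite Gd KdS /= mul0r add0r mul1r.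
have det : A * D - B * C = - pserX ^+ d.
  rewrite transfer_det /= mul0r subr0 mulr1 mul1r.
  transitivity (\prod_(i < d) (pserC (- p ^+ i) * pserX)).
    by apply: eq_bigr => i _; rewrite rmorphN mulNr.
  rewrite big_split /= -rmorph_prod prod_opp_prim_root rmorphN rmorph1 mulN1r.
  by rewrite prodr_const card_ord.
pose T := A + D.
have quad : Kd * Kd = T * Kd + pserX ^+ d.
  rewrite -[pserX ^+ d]opprK -det /T.
  have BE : B = G 0 * Kd - A * G 0 by rewrite -eq1; ring.
  have DE : D = Kd - C * G 0 by rewrite -eq2; ring.
  by rewrite BE DE; ring.
have dilT : dilate p T = T.
  apply: (pser_mulI prod_qcf_at0).
  have := congr1 (dilate p) quad.
  rewrite rmorphD !rmorphM /= dilate_prod_qcf rmorphXn /= dilate_pserX exprMn.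
  rewrite -rmorphXn (prim_expr_order p_prim) rmorph1 mul1r quad => /addIr.
  by rewrite ![Kd * _]mulrC => ->.
have T0 : T 0%N = 1.
  have := congr1 (@^~ 0%N) quad.
  rewrite pserDE !pserM0 prod_qcf_at0 !mulr1 => ->.
  by rewrite -[pserX ^+ d]mulr1 pserXn_mul d_gt0 addr0.
(* Invariance under z -> pz kills the coefficients of z^n for 0 < n < d, and the
   degree bound on the transfer matrices kills those for n >= d. *)
have T1 : T = 1.
  apply/pserP => n; rewrite pser1E.
  have [->|n_neq0] := eqVneq n 0%N; first exact: T0.
  have [ltnd|ledn] := ltnP n d.
    apply/eqP; have /eqP := congr1 (@^~ n) dilT.
    rewrite dilateE -subr_eq0 -{2}[T n]mul1r -mulrBl mulf_eq0 => /orP[|//].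
    rewrite subr_eq0 -(prim_order_dvd p_prim) => /dvdn_leq.
    by rewrite lt0n n_neq0 leqNgt ltnd => /(_ isT).
  have const0 i : (0 < i)%N -> (0 : pser K) i = 0 by [].
  rewrite /T /A /D pserDE; case: d d_gt0 ledn => // m _ ltmn.
  rewrite (transfer_row_order (r := r1) const1 const0 ltmn).1 add0r.
  case: n ltmn {n_neq0} => // n; rewrite ltnS => lemn.
  (* The bound on second entries would allow degree d in D. One step is unfolded instead: the first
     entry after m steps from (0, 1) is 0 if m = 0 and has degree below m otherwise. *)
  rewrite -[LHS]/((Z m * (transfer_row r2 m).1) n.+1) -mulrA pserC_mul pserX_mulS.
  case: m lemn => [|m] ltmn; first exact: mulr0.
  by rewrite (transfer_row_order (r := r2) const0 const1 ltmn).1 mulr0.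
by rewrite quad T1 mul1r.
Qed.

(** * Logarithmic derivative over a period and central binomial coefficients *)

Let Lam := \sum_(i < d) dilate (p ^+ i) (qcf_dlog p).

Lemma theta_prod_qcf : theta Kd = Kd * Lam.
Proof.
rewrite /Kd /Lam; elim: d => [|k IHk]; first by rewrite !big_ord0 theta1 mulr0.
rewrite !big_ord_recr /= thetaM IHk {2}/G theta_dilate theta_qcf dilateM -/(G k).
by ring.
Qed.

Lemma sum_dilate_qcf_dlog n : Lam (d * n)%N = d%:R * qcf_dlog p (d * n)%N.
Proof.
rewrite /Lam pser_sumE (eq_bigr (fun=> qcf_dlog p (d * n)%N)) => [|i _].
  by rewrite sumr_const card_ord mulr_natl.
rewrite dilateE -exprM mulnC -mulnA [(n * i)%N]mulnC.
by rewrite exprM (prim_expr_order p_prim) expr1n mul1r.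
Qed.

(* X = d (1 + 4 z^d)^(-1/2). *)
Let X := d%:R - 2 * Lam.

(** W = 2 Kd - 1 satisfies W^2 = 1 + 4 z^d and X W = d. Clearing denominators in theta X / X = -
    theta W / W gives a linear equation free of square roots. *)
Lemma theta_discriminant :
  theta X * (1 + 4 * pserX ^+ d) = - (2 * d%:R * pserX ^+ d * X).
Proof.
have quad := prod_qcf_quadratic; have dK := theta_prod_qcf.
set Y := pserX ^+ d in quad *; pose W := 2 * Kd - 1.
have WW : W * W = 1 + 4 * Y.
  transitivity (4 * (Kd * Kd) - 4 * Kd + 1); first by rewrite /W; ring.
  by rewrite quad; ring.
have thetaW : theta W = 2 * theta Kd.
  by rewrite /W thetaD thetaN theta1 subr0 !mulr_natl thetaMn.
have dY : W * theta Kd = d%:R * Y.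
  have := congr1 (@theta K) quad; rewrite thetaM thetaD theta_pserXn -mulr_natl -/Y.
  move=> dquad; transitivity (theta Kd * Kd + Kd * theta Kd - theta Kd).
    by rewrite /W; ring.
  by rewrite dquad; ring.
have WLam : W * Lam = d%:R * (Kd - 1).
  apply: (pser_mulI prod_qcf_at0).
  rewrite mulrCA -dK dY; transitivity (d%:R * (Kd * Kd - Kd)); last by ring.
  by rewrite quad; ring.
have XW : X * W = d%:R.
  transitivity (d%:R * W - 2 * (W * Lam)); first by rewrite /X; ring.
  by rewrite WLam /W; ring.
have dXW : theta X * W = - (X * theta W).
  apply/eqP; rewrite -subr_eq0 opprK -thetaM XW -[d%:R]/(1 *+ d).
  by rewrite thetaMn theta1 mul0rn.
rewrite -WW mulrA dXW.
transitivity (- (2 * X * (W * theta Kd))); first by rewrite thetaW; ring.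
by rewrite dY; ring.
Qed.

Lemma discriminant_coefS n :
  X (d * n.+1)%N * n.+1%:R = - (2 * (2 * n).+1%:R * X (d * n)%N).
Proof.
have d_neq0 : d%:R != 0 :> K by case: d d_gt0.
apply: (mulfI d_neq0).
have := congr1 (@^~ (d * n.+1)%N) theta_discriminant.
have -> : theta X * (1 + 4 * pserX ^+ d)
    = theta X + (pserX ^+ d * theta X) *+ 4 by ring.
have -> : 2 * d%:R * pserX ^+ d * X = (pserX ^+ d * X) *+ (2 * d).
  by rewrite -[RHS]mulr_natl natrM !mulrA.
rewrite pserDE pserNE !pserMnE !pserXn_mul ltnNge leq_pmulr //= !thetaE.
rewrite mulnS addKn -mulnS.
move: (X (d * n.+1)%N) (X (d * n)%N) => a b.
rewrite -(mulr_natl a) -(mulr_natl b (d * n)) -(mulr_natl b (2 * d)).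
rewrite -(mulr_natl (_ * b)) -[(2 * n).+1]addn1 -[n.+1]addn1 !(natrM, natrD).
move: (d%:R : K) (n%:R : K) => dK nK ab.
transitivity ((dK * (nK + 1) * a + 4 * (dK * nK * b)) - 4 * (dK * nK * b)).
  by ring.
by rewrite ab; ring.
Qed.

Lemma central_binomialS n :
  (n.+1 * 'C(2 * n.+1, n.+1) = 2 * (2 * n).+1 * 'C(2 * n, n))%N.
Proof.
have := mul_bin_diag (2 * n).+2 n; have := mul_bin_down (2 * n).+1 n.
rewrite /= mulnS add2n; have -> : ((2 * n).+1 - n = n.+1)%N by lia.
by move=> down <-; rewrite -mulnA down; lia.
Qed.

Lemma central_binomialE n : 'C(2 * n.+1, n.+1) = (2 * 'C((2 * n.+1).-1, n))%N.
Proof.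
apply/eqP; rewrite -(eqn_pmul2l (ltn0Sn n)) -mul_bin_diag; apply/eqP.
by lia.
Qed.

Lemma discriminantE n :
  X (d * n)%N = (n == 0%N)%:R *+ d - (d%:R * qcf_dlog p (d * n)%N) *+ 2.
Proof.
rewrite /X pserDE pserNE [2 * Lam]mulr_natl !pserMnE pser1E.
by rewrite sum_dilate_qcf_dlog muln_eq0 gtn_eqF.
Qed.

(** This is (1 + 4y)^(-1/2) = \sum (-1)^n binom(2n,n) y^n with y = z^d: both sides satisfy the same
    first-order recurrence. *)
Lemma discriminant_coef n : X (d * n)%N = d%:R * (-1) ^+ n * 'C(2 * n, n)%:R.
Proof.
elim: n => [|n IHn].
  rewrite discriminantE muln0 qcf_dlog_at0 mulr0 mul0rn subr0 bin0.
  by rewrite !mulr1.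
apply: (mulIf (charK n)); rewrite discriminant_coefS IHn.
transitivity (d%:R * (-1) ^+ n.+1 * (n.+1 * 'C(2 * n.+1, n.+1))%:R : K).
  by rewrite central_binomialS !natrM exprS; ring.
by rewrite natrM; ring.
Qed.

Lemma qcf_dlog_prim_root n : (0 < n)%N ->
  qcf_dlog p (d * n)%N = (-1) ^+ n.-1 * 'C((2 * n).-1, n.-1)%:R.
Proof.
case: n => // n _; have := discriminant_coef n.+1.
have d_neq0 : d%:R != 0 :> K by case: d d_gt0.
rewrite discriminantE central_binomialE mul0rn sub0r -(mulr_natl (_ * _) 2).
rewrite natrM => eqX.
apply: (mulfI d_neq0); apply: (mulfI (charK 1)); apply: oppr_inj.
by rewrite [LHS]eqX exprS /=; ring.
Qed.

End RootOfUnity.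

Theorem theorem2p7 :
  exists P : nat -> {poly int},
    [/\ h =1 (fun n : nat => if n == 0%N then 0 else
               (-1) ^+ n.-1 * evalZ (P n) q
                 / (n%:R * q ^+ 'C(n, 2) * (q ^+ n - 1))),
        (forall n : nat, (0 < n)%N -> size (P n) = 'C(n, 2).+1)
      & (forall (d n : nat) (C : numClosedFieldType) (w : C),
           (0 < d)%N -> (0 < n)%N -> d.-primitive_root w ->
           evalZ (P (d * n)%N) w = 'C((2 * n).-1, n.-1)%:R)].
Proof.
exists qlog_poly; split=> [n|n|d n C w d_gt0 n_gt0 w_prim].
- exact: qlog_poly_log.
- exact: size_qlog_poly.
have charC k : k.+1%:R != 0 :> C by rewrite Num.Theory.pnatr_eq0.
have w0 : w != 0.
  apply: contra_eq_neq (prim_expr_order w_prim) => ->.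
  by rewrite expr0n gtn_eqF // eq_sym oner_neq0.
(* Reversal evaluates g at 1/w, which is w^(d-1) with d - 1 coprime to d. *)
have wV_prim : d.-primitive_root w^-1.
  have -> : w^-1 = w ^+ d.-1.
    by apply: (mulfI w0); rewrite mulfV // -exprS prednK // prim_expr_order.
  by rewrite prim_root_exp_coprime // coprime_sym coprimenP.
have dn_gt0 : (0 < d * n)%N by rewrite muln_gt0 d_gt0.
(* The prefactor of the reversal collapses to the sign carried by g_(dn)(1/w), so the two cancel. *)
have sign_eq : (-1) ^+ (d * n).-1 * w ^+ 'C(d * n, 2) = (-1) ^+ n.-1 :> C.
  have N1 : -1 != 0 :> C by rewrite oppr_eq0 oner_eq0.
  apply: (mulfI N1); rewrite mulrA -!exprS !prednK //.
  exact: prod_opp_prim_root_mul.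
rewrite evalZ_qlog_poly // (qcf_dlog_prim_root d_gt0 wV_prim charC n_gt0) mulrA.
by rewrite sign_eq -expr2 sqrr_sign mul1r.
Qed.
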